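(* Let $u(t)=\exp(te)$ and $v(t)=\exp(tf)$ be the one-parameter subgroups corresponding to the generators $e,f$ of $\mathfrak{eb}_2$. Then $$u(t_1)v(t_2)u(t_3)v(t_4)=v(p_1)u(p_2)v(p_3)u(p_4),$$ where $$p_1=\frac{t_2t_3^2t_4}{\pi_2},\quad p_2=\frac{\pi_2}{\pi_1},\quad p_3=\frac{\pi_1^2}{\pi_2},\quad p_4=\frac{t_1t_2t_3}{\pi_1},$$ and $$\pi_1=t_1t_2+(t_1+t_3)t_4+t_1t_2t_3t_4,\qquad \pi_2=t_1^2t_2+(t_1+t_3)^2t_4+t_1t_2t_3t_4(t_1+t_3).$$
   Context: $\mathfrak{eb}_2$ (the electrical Lie algebra of type $B_2$) is the real Lie algebra generated by two generators $e,f$ subject to the relations $[e,[e,[e,f]]]=0$ and $[f,[f,e]]=-2f$. It is isomorphic to $\mathfrak{gl}_2$ via $e\mapsto\begin{pmatrix}1&1\\0&1\end{pmatrix}$, $f\mapsto\begin{pmatrix}0&0\\1&0\end{pmatrix}$. Here $\exp$ is the exponential map from the Lie algebra to a corresponding Lie group, and $t_1,t_2,t_3,t_4$ are the parameters of the one-parameter subgroups. *)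

(* Defs.v *)
From HB Require Import structures.
From mathcomp Require Import all_boot all_order all_algebra ring.
From mathcomp Require Import all_classical all_reals all_analysis.
Import GRing.Theory numFieldNormedType.Exports.

Set Implicit Arguments.
Unset Strict Implicit.
Unset Printing Implicit Defensive.

Local Open Scope ring_scope.
Local Open Scope quotient_scope.

HB.mixin Record Lmodule_isLie (R : comNzRingType) L of GRing.Lmodule R L := {
  lie : L -> L -> L;
  lieDl : forall x y z, lie (x + y) z = lie x z + lie y z;
  lieDr : forall x y z, lie x (y + z) = lie x y + lie x z;
  lieZl : forall a x y, lie (a *: x) y = a *: lie x y;
  lieZr : forall a x y, lie x (a *: y) = a *: lie x y;
  liexx : forall x, lie x x = 0;
  lie_jacobi : forall x y z,
    lie x (lie y z) + lie y (lie z x) + lie z (lie x y) = 0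
}.

#[short(type="lieAlgType")]
HB.structure Definition LieAlgebra (R : comNzRingType) :=
  {L of GRing.Lmodule R L & Lmodule_isLie R L}.

Section LieTheory.
Variables (R : comNzRingType) (L : lieAlgType R).
Implicit Types x y z : L.

Lemma lieC x y : lie x y = - lie y x.
Proof.
apply/eqP; rewrite -addr_eq0.
have := liexx (x + y); rewrite lieDl !lieDr !liexx add0r addr0.
by move=> ->; rewrite eqxx.
Qed.

Lemma lieNl x y : lie (- x) y = - lie x y.
Proof. by rewrite -scaleN1r lieZl scaleN1r. Qed.

Lemma lieNr x y : lie x (- y) = - lie x y.
Proof. by rewrite -scaleN1r lieZr scaleN1r. Qed.

Lemma lie0l x : lie 0 x = 0.
Proof. by rewrite -[X in lie X _](scale0r x) lieZl scale0r. Qed.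

Lemma lie0r x : lie x 0 = 0.
Proof. by rewrite -[X in lie _ X](scale0r x) lieZr scale0r. Qed.

Lemma lie_leibniz x y z : lie x (lie y z) = lie (lie x y) z + lie y (lie x z).
Proof.
have /eqP := lie_jacobi x y z; rewrite -addrA addr_eq0 => /eqP->.
by rewrite (lieC z x) lieNr (lieC (lie x y)) opprD opprK addrC.
Qed.

Lemma lie_gl2_table (x f h z : L) (a b c d a' b' c' d' : R) :
  lie x f = h -> lie h x = 2%:R *: x -> lie h f = - 2%:R *: f ->
  lie z x = 0 -> lie z f = 0 -> lie z h = 0 ->
  lie (a *: x + b *: f + c *: h + d *: z)
      (a' *: x + b' *: f + c' *: h + d' *: z) =
  (2%:R * (c * a' - a * c')) *: x + (2%:R * (b * c' - c * b')) *: f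
  + (a * b' - b * a') *: h + 0 *: z.
Proof.
move=> xf hx hf zx zf zh.
have [xz fz hz] : [/\ lie x z = 0, lie f z = 0 & lie h z = 0].
  by split; rewrite lieC ?zx ?zf ?zh oppr0.
have fx : lie f x = - 1 *: h by rewrite lieC xf scaleN1r.
have xh : lie x h = - 2%:R *: x by rewrite lieC hx scaleNr.
have fh : lie f h = 2%:R *: f by rewrite lieC hf scaleNr opprK.
rewrite !(lieDl, lieDr, lieZl, lieZr) !liexx xz fz hz xf fx hx xh hf fh.
rewrite zx zf zh !scaler0 scale0r !addr0 !add0r !scalerA.
have -> : 2%:R * (c * a' - a * c') = c * a' * 2%:R + a * c' * - 2%:R by ring.
have -> : 2%:R * (b * c' - c * b') = b * c' * 2%:R + c * b' * - 2%:R by ring.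
have -> : a * b' - b * a' = a * b' + b * a' * - 1 by ring.
by rewrite !scalerDl [LHS](AC (2*2*2) ((5*2)*(4*6)*(1*3))).
Qed.

End LieTheory.

(* The Lie algebra gl_n. *)
Section GeneralLinear.
Variables (R : comNzRingType) (n : nat).
Implicit Types A B C : 'M[R]_n.

Definition commutator_mx A B := A *m B - B *m A.

Fact commutator_mxDl A B C :
  commutator_mx (A + B) C = commutator_mx A C + commutator_mx B C.
Proof. by rewrite /commutator_mx mulmxDl mulmxDr opprD addrACA. Qed.

Fact commutator_mxDr A B C :
  commutator_mx A (B + C) = commutator_mx A B + commutator_mx A C.
Proof. by rewrite /commutator_mx mulmxDl mulmxDr opprD addrACA. Qed.

Fact commutator_mxZl a A B :
  commutator_mx (a *: A) B = a *: commutator_mx A B.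
Proof. by rewrite /commutator_mx -scalemxAl -scalemxAr scalerBr. Qed.

Fact commutator_mxZr a A B :
  commutator_mx A (a *: B) = a *: commutator_mx A B.
Proof. by rewrite /commutator_mx -scalemxAl -scalemxAr scalerBr. Qed.

Fact commutator_mxx A : commutator_mx A A = 0.
Proof. exact: subrr. Qed.

Fact commutator_mx_jacobi A B C :
  commutator_mx A (commutator_mx B C) + commutator_mx B (commutator_mx C A)
  + commutator_mx C (commutator_mx A B) = 0.
Proof.
rewrite /commutator_mx !mulmxBl !mulmxBr !mulmxA !opprB.
set a := A *m B *m C; set b := A *m C *m B; set c := B *m A *m C.
set d := B *m C *m A; set e := C *m A *m B; set f := C *m B *m A.
by apply/matrixP => i j; rewrite !mxE; ring.
Qed.

HB.instance Definition _ := Lmodule_isLie.Build R 'M[R]_n commutator_mxDl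
  commutator_mxDr commutator_mxZl commutator_mxZr commutator_mxx
  commutator_mx_jacobi.

End GeneralLinear.

(* The electrical Lie algebra eb_2: Lie words in e and f, modulo the least
   congruence containing the axioms of Lie algebras and the two relations. *)
Inductive eb2_word (R : Type) :=
| WE | WF | W0
| WAdd of eb2_word R & eb2_word R
| WScale of R & eb2_word R
| WLie of eb2_word R & eb2_word R.
Arguments WE {R}.
Arguments WF {R}.
Arguments W0 {R}.

HB.instance Definition _ R := gen_eqMixin (eb2_word R).
HB.instance Definition _ R := gen_choiceMixin (eb2_word R).

Section EB2.
Variable R : comNzRingType.
Implicit Types (a b : R) (x y z : eb2_word R).

Inductive eb2_cong : eb2_word R -> eb2_word R -> Prop :=
| eb2_refl x : eb2_cong x x
| eb2_sym x y : eb2_cong x y -> eb2_cong y x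
| eb2_trans x y z : eb2_cong x y -> eb2_cong y z -> eb2_cong x z
| eb2_cong_add x x' y y' :
    eb2_cong x x' -> eb2_cong y y' -> eb2_cong (WAdd x y) (WAdd x' y')
| eb2_cong_scale a x x' : eb2_cong x x' -> eb2_cong (WScale a x) (WScale a x')
| eb2_cong_lie x x' y y' :
    eb2_cong x x' -> eb2_cong y y' -> eb2_cong (WLie x y) (WLie x' y')
| eb2_addA x y z : eb2_cong (WAdd x (WAdd y z)) (WAdd (WAdd x y) z)
| eb2_addC x y : eb2_cong (WAdd x y) (WAdd y x)
| eb2_add0 x : eb2_cong (WAdd W0 x) x
| eb2_addN x : eb2_cong (WAdd (WScale (-1) x) x) W0
| eb2_scaleA a b x : eb2_cong (WScale a (WScale b x)) (WScale (a * b) x)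
| eb2_scale1 x : eb2_cong (WScale 1 x) x
| eb2_scaleDr a x y :
    eb2_cong (WScale a (WAdd x y)) (WAdd (WScale a x) (WScale a y))
| eb2_scaleDl x a b :
    eb2_cong (WScale (a + b) x) (WAdd (WScale a x) (WScale b x))
| eb2_lieDl x y z : eb2_cong (WLie (WAdd x y) z) (WAdd (WLie x z) (WLie y z))
| eb2_lieDr x y z : eb2_cong (WLie x (WAdd y z)) (WAdd (WLie x y) (WLie x z))
| eb2_lieZl a x y : eb2_cong (WLie (WScale a x) y) (WScale a (WLie x y))
| eb2_lieZr a x y : eb2_cong (WLie x (WScale a y)) (WScale a (WLie x y))
| eb2_liexx x : eb2_cong (WLie x x) W0
| eb2_jacobi x y z :
    eb2_cong (WAdd (WAdd (WLie x (WLie y z)) (WLie y (WLie z x)))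
                   (WLie z (WLie x y))) W0
| eb2_rel_e : eb2_cong (WLie WE (WLie WE (WLie WE WF))) W0
| eb2_rel_f : eb2_cong (WLie WF (WLie WF WE)) (WScale (- 2%:R) WF).

Definition eb2_eqv x y : bool := `[< eb2_cong x y >].

Fact eb2_eqv_refl : reflexive eb2_eqv.
Proof. by move=> x; apply/asboolP/eb2_refl. Qed.

Fact eb2_eqv_sym : symmetric eb2_eqv.
Proof. by move=> x y; apply/asboolP/asboolP; apply: eb2_sym. Qed.

Fact eb2_eqv_trans : transitive eb2_eqv.
Proof.
by move=> y x z /asboolP xy /asboolP yz; apply/asboolP/(eb2_trans xy).
Qed.

Canonical eb2_equiv :=
  EquivRel eb2_eqv eb2_eqv_refl eb2_eqv_sym eb2_eqv_trans.

Definition eb2 := {eq_quot eb2_equiv}.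
HB.instance Definition _ := Choice.on eb2.

Definition eb2_pi (x : eb2_word R) : eb2 := \pi_eb2 x.

Lemma eb2_piP x y : eb2_pi x = eb2_pi y <-> eb2_cong x y.
Proof. by split => [/eqmodP/asboolP|xy] //; apply/eqmodP/asboolP. Qed.

Lemma eb2_pi_repr (u : eb2) : eb2_pi (repr u) = u.
Proof. exact: reprK. Qed.

Lemma eb2_repr_pi x : eb2_cong (repr (eb2_pi x)) x.
Proof. exact/eb2_piP/eb2_pi_repr. Qed.

Lemma eb2_piW (P : eb2 -> Prop) : (forall x, P (eb2_pi x)) -> forall u, P u.
Proof. by move=> Ppi u; rewrite -(eb2_pi_repr u). Qed.

Definition eb2_add (u v : eb2) := eb2_pi (WAdd (repr u) (repr v)).
Definition eb2_scale a (u : eb2) := eb2_pi (WScale a (repr u)).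
Definition eb2_lie (u v : eb2) := eb2_pi (WLie (repr u) (repr v)).

Lemma eb2_addE x y : eb2_add (eb2_pi x) (eb2_pi y) = eb2_pi (WAdd x y).
Proof. by apply/eb2_piP/eb2_cong_add; apply: eb2_repr_pi. Qed.

Lemma eb2_scaleE a x : eb2_scale a (eb2_pi x) = eb2_pi (WScale a x).
Proof. by apply/eb2_piP/eb2_cong_scale; apply: eb2_repr_pi. Qed.

Lemma eb2_lieE x y : eb2_lie (eb2_pi x) (eb2_pi y) = eb2_pi (WLie x y).
Proof. by apply/eb2_piP/eb2_cong_lie; apply: eb2_repr_pi. Qed.

Let piE := (eb2_addE, eb2_scaleE, eb2_lieE).

Fact eb2_addrA : associative eb2_add.
Proof.
by do 3![elim/eb2_piW => ?]; rewrite !piE; apply/eb2_piP/eb2_addA.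
Qed.

Fact eb2_addrC : commutative eb2_add.
Proof. by do 2![elim/eb2_piW => ?]; rewrite !piE; apply/eb2_piP/eb2_addC. Qed.

Fact eb2_add0r : left_id (eb2_pi W0) eb2_add.
Proof. by elim/eb2_piW => ?; rewrite !piE; apply/eb2_piP/eb2_add0. Qed.

Fact eb2_addNr : left_inverse (eb2_pi W0) (eb2_scale (-1)) eb2_add.
Proof. by elim/eb2_piW => ?; rewrite !piE; apply/eb2_piP/eb2_addN. Qed.

HB.instance Definition _ :=
  GRing.isZmodule.Build eb2 eb2_addrA eb2_addrC eb2_add0r eb2_addNr.

Fact eb2_scalerA a b (u : eb2) :
  eb2_scale a (eb2_scale b u) = eb2_scale (a * b) u.
Proof. by elim/eb2_piW: u => ?; rewrite !piE; apply/eb2_piP/eb2_scaleA. Qed.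

Fact eb2_scale1r : left_id 1 eb2_scale.
Proof. by elim/eb2_piW => ?; rewrite !piE; apply/eb2_piP/eb2_scale1. Qed.

Fact eb2_scalerDr : right_distributive eb2_scale +%R.
Proof.
move=> a; do 2![elim/eb2_piW => ?]; rewrite /GRing.add /= !piE.
exact/eb2_piP/eb2_scaleDr.
Qed.

Fact eb2_scalerDl (u : eb2) : {morph eb2_scale^~ u : a b / a + b}.
Proof.
elim/eb2_piW: u => ? a b; rewrite /= !piE [RHS]/GRing.add /= !piE.
exact/eb2_piP/eb2_scaleDl.
Qed.

HB.instance Definition _ := GRing.Zmodule_isLmodule.Build R eb2
  eb2_scalerA eb2_scale1r eb2_scalerDr eb2_scalerDl.

Lemma eb2_piD x y : eb2_pi (WAdd x y) = eb2_pi x + eb2_pi y.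
Proof. exact/esym/eb2_addE. Qed.

Lemma eb2_piZ a x : eb2_pi (WScale a x) = a *: eb2_pi x.
Proof. exact/esym/eb2_scaleE. Qed.

Lemma eb2_pi0 : eb2_pi W0 = 0. Proof. by []. Qed.

Let piE' := (eb2_lieE, =^~ eb2_piD, =^~ eb2_piZ, =^~ eb2_pi0).

Fact eb2_lierDl (u v w : eb2) : eb2_lie (u + v) w = eb2_lie u w + eb2_lie v w.
Proof.
elim/eb2_piW: u => ?; elim/eb2_piW: v => ?; elim/eb2_piW: w => ?.
by rewrite !piE'; apply/eb2_piP/eb2_lieDl.
Qed.

Fact eb2_lierDr (u v w : eb2) : eb2_lie u (v + w) = eb2_lie u v + eb2_lie u w.
Proof.
elim/eb2_piW: u => ?; elim/eb2_piW: v => ?; elim/eb2_piW: w => ?.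
by rewrite !piE'; apply/eb2_piP/eb2_lieDr.
Qed.

Fact eb2_lierZl a (u v : eb2) : eb2_lie (a *: u) v = a *: eb2_lie u v.
Proof.
elim/eb2_piW: u => ?; elim/eb2_piW: v => ?.
by rewrite !piE'; apply/eb2_piP/eb2_lieZl.
Qed.

Fact eb2_lierZr a (u v : eb2) : eb2_lie u (a *: v) = a *: eb2_lie u v.
Proof.
elim/eb2_piW: u => ?; elim/eb2_piW: v => ?.
by rewrite !piE'; apply/eb2_piP/eb2_lieZr.
Qed.

Fact eb2_lierxx (u : eb2) : eb2_lie u u = 0.
Proof. by elim/eb2_piW: u => ?; rewrite !piE'; apply/eb2_piP/eb2_liexx. Qed.

Fact eb2_lier_jacobi (u v w : eb2) :
  eb2_lie u (eb2_lie v w) + eb2_lie v (eb2_lie w u) + eb2_lie w (eb2_lie u v)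
  = 0.
Proof.
elim/eb2_piW: u => ?; elim/eb2_piW: v => ?; elim/eb2_piW: w => ?.
by rewrite !piE'; apply/eb2_piP/eb2_jacobi.
Qed.

HB.instance Definition _ := Lmodule_isLie.Build R eb2 eb2_lierDl eb2_lierDr
  eb2_lierZl eb2_lierZr eb2_lierxx eb2_lier_jacobi.

Lemma eb2_piL x y : eb2_pi (WLie x y) = lie (eb2_pi x) (eb2_pi y).
Proof. exact/esym/eb2_lieE. Qed.

Definition eb2_e : eb2 := eb2_pi WE.
Definition eb2_f : eb2 := eb2_pi WF.

Lemma eb2_relE : lie eb2_e (lie eb2_e (lie eb2_e eb2_f)) = 0.
Proof. by have /eb2_piP := eb2_rel_e; rewrite !eb2_piL. Qed.

Lemma eb2_relF : lie eb2_f (lie eb2_f eb2_e) = - 2%:R *: eb2_f.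
Proof. by have /eb2_piP := eb2_rel_f; rewrite !eb2_piL eb2_piZ. Qed.

Section Lift.
Variables (L : lieAlgType R) (E F : L).

Fixpoint eb2_eval x : L :=
  match x with
  | WE => E
  | WF => F
  | W0 => 0
  | WAdd y z => eb2_eval y + eb2_eval z
  | WScale a y => a *: eb2_eval y
  | WLie y z => lie (eb2_eval y) (eb2_eval z)
  end.

(* The Lie algebra morphism eb_2 -> L sending e to E and f to F; it is well
   defined when E and F satisfy the relations (eb2_lift_pi). *)
Definition eb2_lift (u : eb2) : L := eb2_eval (repr u).

Hypothesis relE : lie E (lie E (lie E F)) = 0.
Hypothesis relF : lie F (lie F E) = - 2%:R *: F.

Lemma eb2_eval_cong x y : eb2_cong x y -> eb2_eval x = eb2_eval y.
Proof.
elim=> //=; try by move=> *; congruence.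
- by move=> *; rewrite addrA.
- by move=> *; rewrite addrC.
- by move=> *; rewrite add0r.
- by move=> *; rewrite scaleN1r addNr.
- by move=> *; rewrite scalerA.
- by move=> *; rewrite scale1r.
- by move=> *; rewrite scalerDr.
- by move=> *; rewrite scalerDl.
- by move=> *; rewrite lieDl.
- by move=> *; rewrite lieDr.
- by move=> *; rewrite lieZl.
- by move=> *; rewrite lieZr.
- by move=> *; rewrite liexx.
- by move=> *; rewrite lie_jacobi.
Qed.

Lemma eb2_lift_pi x : eb2_lift (eb2_pi x) = eb2_eval x.
Proof. exact/eb2_eval_cong/eb2_repr_pi. Qed.

Lemma eb2_liftD : {morph eb2_lift : u v / u + v}.
Proof.
by do 2![elim/eb2_piW => ?]; rewrite -eb2_piD !eb2_lift_pi.
Qed.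

Lemma eb2_liftZ a : {morph eb2_lift : u / a *: u}.
Proof. by elim/eb2_piW => ?; rewrite -eb2_piZ !eb2_lift_pi. Qed.

Lemma eb2_lift_lie : {morph eb2_lift : u v / lie u v}.
Proof.
by do 2![elim/eb2_piW => ?]; rewrite -eb2_piL !eb2_lift_pi.
Qed.

End Lift.
End EB2.

Section IsoGL2.
Variable R : fieldType.

Definition gl2_e : 'M[R]_2 := \matrix_(i, j) (i <= j)%N%:R.
Definition gl2_f : 'M[R]_2 := delta_mx 1 0.

Definition eb2_to_gl2 : eb2 R -> 'M[R]_2 := eb2_lift gl2_e gl2_f.

Lemma mx2P (A B : 'M[R]_2) :
  A 0 0 = B 0 0 -> A 0 1 = B 0 1 -> A 1 0 = B 1 0 -> A 1 1 = B 1 1 -> A = B.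
Proof.
move=> h00 h01 h10 h11; apply/matrixP => i j.
have I2 (k : 'I_2) : k = 0 \/ k = 1.
  by case: k => [[|[|k]] hk] //; [left|right]; apply/val_inj.
by case: (I2 i) => ->; case: (I2 j) => ->.
Qed.

Lemma lie_mx2E (A B : 'M[R]_2) i j : lie A B i j =
  A i 0 * B 0 j + A i 1 * B 1 j - (B i 0 * A 0 j + B i 1 * A 1 j).
Proof.
rewrite [lie A B]/(commutator_mx A B) !mxE !big_ord_recl !big_ord0 !addr0.
by congr (_ + A i _ * B _ j - (_ + B i _ * A _ j)); apply/val_inj.
Qed.

Lemma gl2_relE : lie gl2_e (lie gl2_e (lie gl2_e gl2_f)) = 0.
Proof. by apply: mx2P; rewrite !(lie_mx2E, mxE) /=; ring. Qed.

Lemma gl2_relF : lie gl2_f (lie gl2_f gl2_e) = - 2%:R *: gl2_f.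
Proof. by apply: mx2P; rewrite !(lie_mx2E, mxE) /=; ring. Qed.

Lemma eb2_to_gl2D : {morph eb2_to_gl2 : u v / u + v}.
Proof. exact: eb2_liftD gl2_relE gl2_relF. Qed.

Lemma eb2_to_gl2Z a : {morph eb2_to_gl2 : u / a *: u}.
Proof. exact: eb2_liftZ gl2_relE gl2_relF a. Qed.

Lemma eb2_to_gl2_lie : {morph eb2_to_gl2 : u v / lie u v}.
Proof. exact: eb2_lift_lie gl2_relE gl2_relF. Qed.

Lemma eb2_to_gl2_e : eb2_to_gl2 (eb2_e R) = gl2_e.
Proof. exact: (eb2_lift_pi gl2_relE gl2_relF). Qed.

Lemma eb2_to_gl2_f : eb2_to_gl2 (eb2_f R) = gl2_f.
Proof. exact: (eb2_lift_pi gl2_relE gl2_relF). Qed.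

Section Inverse.
Hypothesis two_neq0 : 2%:R != 0 :> R.

Let e : eb2 R := eb2_e R.
Let f : eb2 R := eb2_f R.
Let h : eb2 R := lie e f.
Let x : eb2 R := - 2%:R^-1 *: lie e h.
Let z : eb2 R := e - x.

Let lie_eh : lie e h = - 2%:R *: x.
Proof. by rewrite /x scalerA mulrNN mulfV // scale1r. Qed.

Let lie_ex : lie e x = 0.
Proof. by rewrite /x lieZr eb2_relE scaler0. Qed.

Let lie_hf : lie h f = - 2%:R *: f.
Proof. by rewrite lieC /h (lieC e f) lieNr opprK eb2_relF. Qed.

Let lie_xf : lie x f = h.
Proof.
have lie_e_hf : lie e (lie h f) = - 2%:R *: h by rewrite lie_hf lieZr.
have : lie e (lie h f) = lie (lie e h) f.
  by rewrite lie_leibniz liexx addr0.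
by rewrite lie_e_hf lie_eh lieZl => /scalerI ->; rewrite ?oppr_eq0.
Qed.

Let lie_xh : lie x h = - 2%:R *: x.
Proof.
have : lie e (lie x f) = lie x (lie e f).
  by rewrite lie_leibniz lie_ex lie0l add0r.
by rewrite lie_xf lie_eh.
Qed.

Let lie_ze : lie z e = 0.
Proof. by rewrite lieDl lieNl liexx (lieC x) lie_ex oppr0 subr0. Qed.

Let lie_zf : lie z f = 0.
Proof. by rewrite lieDl lieNl lie_xf subrr. Qed.

Let lie_zh : lie z h = 0.
Proof. by rewrite lieDl lieNl lie_xh lie_eh subrr. Qed.

Let lie_zx : lie z x = 0.
Proof. by rewrite lieDl lieNl lie_ex liexx subrr. Qed.

Let g (A : 'M[R]_2) : eb2 R :=
  A 0 1 *: x + A 1 0 *: f + (2%:R^-1 * (A 0 0 - A 1 1)) *: h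
  + (2%:R^-1 * (A 0 0 + A 1 1)) *: z.

Let gD : {morph g : A B / A + B}.
Proof.
move=> A B; rewrite /g !mxE.
have -> : 2%:R^-1 * (A 0 0 + B 0 0 - (A 1 1 + B 1 1)) =
  2%:R^-1 * (A 0 0 - A 1 1) + 2%:R^-1 * (B 0 0 - B 1 1) by ring.
have -> : 2%:R^-1 * (A 0 0 + B 0 0 + (A 1 1 + B 1 1)) =
  2%:R^-1 * (A 0 0 + A 1 1) + 2%:R^-1 * (B 0 0 + B 1 1) by ring.
by rewrite !scalerDl [LHS](AC (2*2*2*2) ((1*3*5*7)*(2*4*6*8))).
Qed.

Let gZ a : {morph g : A / a *: A}.
Proof.
have scale4 (v1 v2 v3 v4 : eb2 R) b1 b2 b3 b4 :
    a *: (b1 *: v1 + b2 *: v2 + b3 *: v3 + b4 *: v4) =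
    (a * b1) *: v1 + (a * b2) *: v2 + (a * b3) *: v3 + (a * b4) *: v4.
  by rewrite !scalerDr !scalerA.
move=> A; rewrite /g scale4 !mxE.
by congr (_ *: _ + _ *: _ + _ *: _ + _ *: _); ring.
Qed.

Let g_lie : {morph g : A B / lie A B}.
Proof.
move=> A B; rewrite /g lie_gl2_table //; last first.
  by rewrite lieC lie_xh scaleNr opprK.
rewrite !lie_mx2E.
by congr (_ *: _ + _ *: _ + _ *: _ + _ *: _); field.
Qed.

Let g_e : g gl2_e = e.
Proof.
rewrite /g !mxE /= subrr mulr0 !scale0r !addr0 scale1r -[1 + 1]/(2%:R).
by rewrite mulVf // scale1r addrC subrK.
Qed.

Let g_f : g gl2_f = f.
Proof.
by rewrite /g !mxE /= subrr addr0 !mulr0 !scale0r scale1r !addr0 add0r.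
Qed.

Let eb2_to_gl2K : cancel eb2_to_gl2 g.
Proof.
elim/eb2_piW => w; rewrite /eb2_to_gl2 (eb2_lift_pi gl2_relE gl2_relF).
elim: w => //=.
- have -> : 0 = 0 *: gl2_e by rewrite scale0r.
  by rewrite gZ scale0r.
- by move=> u hu v hv; rewrite gD hu hv eb2_piD.
- by move=> a u hu; rewrite gZ hu eb2_piZ.
- by move=> u hu v hv; rewrite g_lie hu hv eb2_piL.
Qed.

Let gK : cancel g eb2_to_gl2.
Proof.
move=> A; rewrite /g /z /x /h /e /f.
rewrite !(eb2_to_gl2D, eb2_to_gl2Z, eb2_to_gl2_lie, eb2_to_gl2_e,
  eb2_to_gl2_f, =^~ scaleN1r).
by apply: mx2P; rewrite !(lie_mx2E, mxE) /=; field.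
Qed.

Lemma eb2_to_gl2_bij : bijective eb2_to_gl2.
Proof. exact: Bijective eb2_to_gl2K gK. Qed.

End Inverse.
End IsoGL2.

Definition mexp (R : realType) n (A : 'M[R]_n.+1) : 'M[R]_n.+1 :=
  limn (series (fun k => k`!%:R^-1 *: A ^+ k)).

(* The exponential map of eb_2 to the Lie group GL_2(R), whose Lie algebra gl_2
   is identified with eb_2 by eb2_to_gl2 (an isomorphism: eb2_to_gl2_bij). *)
Definition eb2_exp (R : realType) (u : eb2 R) : 'M[R]_2 := mexp (eb2_to_gl2 u).

Definition eb2_u (R : realType) (t : R) : 'M[R]_2 := eb2_exp (t *: eb2_e R).
Definition eb2_v (R : realType) (t : R) : 'M[R]_2 := eb2_exp (t *: eb2_f R).

(* Main.v *)
Require Import Defs.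
From mathcomp Require Import all_boot all_order all_algebra.
From mathcomp Require Import all_classical all_reals all_analysis.
From mathcomp Require Import ring.
Import GRing.Theory Num.Theory numFieldNormedType.Exports.
Local Open Scope ring_scope.

(** Under the identification of eb_2 with gl_2, the element te is t times the
    identity plus the nilpotent matrix t E_01, and tf is the nilpotent matrix
    t E_10.  If N squares to zero then exp (a + N) = e^a (1 + N)
    ([mexp_scalarD_sqr0]), so u(t) is e^t times an upper unitriangular matrix
    and v(t) is lower unitriangular.  The scalar factors of the two sides are
    e^(t1 + t3) and e^(p2 + p4); they agree because of the polynomial identity
    pi2 + t1 t2 t3 = (t1 + t3) pi1.  What remains is an equality between two
    products of unitriangular matrices in SL_2, whose four entries are rational
    functions of the t_i with denominators dividing a power of pi1 pi2. *)

(** The binomial expansion of [(a + N) ^+ k] stops after the term linear in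
    [N]. *)
Lemma exprD_sqr0 (R : comNzRingType) n (a : R) (N : 'M[R]_n.+1) k :
  N * N = 0 ->
  (a%:M + N) ^+ k.+1 = a ^+ k.+1 *: 1 + (k.+1%:R * a ^+ k) *: N.
Proof.
move=> N0; elim: k => [|k IHk].
  by rewrite !expr1 expr0 mulr1 scale1r -scalemx1.
rewrite exprS IHk -scalemx1 mulrDl !mulrDr -!scalerAl -!scalerAr !mul1r mulr1.
rewrite N0 !scaler0 addr0 !scalerA -exprS -addrA -scalerDl.
congr (_ + _ *: _).
by rewrite [k.+2%:R]mulrSr (exprS a k); ring.
Qed.

(** Both coefficients of the exponential series, that of the identity and that
    of [N], are exponential series of [a], the second one shifted by one index,
    whence the common factor [expR a]. *)
Lemma mexp_scalarD_sqr0 (R : realType) n (a : R) (N : 'M[R]_n.+1) :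
  N * N = 0 -> mexp (a%:M + N) = expR a *: (1 + N).
Proof.
move=> N0.
pose d k := if k is k'.+1 then exp_coeff a k' else 0.
have coefE k : k`!%:R^-1 *: (a%:M + N) ^+ k = exp_coeff a k *: 1 + d k *: N.
  case: k => [|k].
    by rewrite /exp_coeff /= !expr0 scale0r addr0 mul1r.
  rewrite exprD_sqr0 // scalerDr !scalerA /exp_coeff /= [_^-1 * _]mulrC.
  congr (_ + _ *: _).
  have k1 : k.+1%:R != 0 :> R by rewrite pnatr_eq0.
  have kf : k`!%:R != 0 :> R by rewrite pnatr_eq0 -lt0n fact_gt0.
  by rewrite factS natrM /d /exp_coeff /=; field; rewrite kf nat1r k1.
have cvg_exp : (series (exp_coeff a) @ \oo --> expR a)%classic.
  exact: is_cvg_series_exp_coeff.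
have cvg_d : (series d @ \oo --> expR a)%classic.
  rewrite -cvg_shiftS; apply: cvg_trans cvg_exp.
  apply: near_eq_cvg; near=> m.
  by rewrite /series /= big_nat_recl //= add0r.
rewrite /mexp; apply: cvg_lim => //.
have -> : series (fun k => k`!%:R^-1 *: (a%:M + N) ^+ k) =
    (fun m => series (exp_coeff a) m *: 1 + series d m *: N).
  apply/funext => m; rewrite /series /= !scaler_suml -big_split /=.
  exact: eq_bigr.
by rewrite scalerDr; apply: cvgD; apply: cvgZr_tmp.
Unshelve. all: by end_near. Qed.

Lemma eb2_uE (R : realType) (t : R) :
  eb2_u t = expR t *: (1 + t *: delta_mx 0 1).
Proof.
rewrite /eb2_u /eb2_exp eb2_to_gl2Z eb2_to_gl2_e.
rewrite -mexp_scalarD_sqr0; last first.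
  by rewrite -scalerAl -scalerAr [_ * _]mul_delta_mx_0 ?scaler0.
congr mexp; apply: mx2P; rewrite !mxE /=; ring.
Qed.

Lemma eb2_vE (R : realType) (t : R) : eb2_v t = 1 + t *: delta_mx 1 0.
Proof.
rewrite /eb2_v /eb2_exp eb2_to_gl2Z eb2_to_gl2_f.
rewrite -[RHS]scale1r -expR0 -mexp_scalarD_sqr0; last first.
  by rewrite -scalerAl -scalerAr [_ * _]mul_delta_mx_0 ?scaler0.
by rewrite raddf0 add0r.
Qed.

Lemma mulmx2E (R : comNzRingType) (A B : 'M[R]_2) i j :
  (A *m B) i j = A i 0 * B 0 j + A i 1 * B 1 j.
Proof.
rewrite mxE !big_ord_recl big_ord0 addr0.
by congr (_ + A i _ * B _ j); apply/val_inj.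
Qed.

Theorem proposition5p7 (R : realType) (t1 t2 t3 t4 : R) :
  let u : R -> 'M[R]_2 := @eb2_u R in
  let v : R -> 'M[R]_2 := @eb2_v R in
  let pi1 := t1 * t2 + (t1 + t3) * t4 + t1 * t2 * t3 * t4 in
  let pi2 := t1 ^+ 2 * t2 + (t1 + t3) ^+ 2 * t4
             + t1 * t2 * t3 * t4 * (t1 + t3) in
  let p1 := t2 * t3 ^+ 2 * t4 / pi2 in
  let p2 := pi2 / pi1 in
  let p3 := pi1 ^+ 2 / pi2 in
  let p4 := t1 * t2 * t3 / pi1 in
  pi1 != 0 -> pi2 != 0 ->
  u t1 *m v t2 *m u t3 *m v t4 = v p1 *m u p2 *m v p3 *m u p4.
Proof.
move=> u v pi1 pi2 p1 p2 p3 p4 pi1_neq0 pi2_neq0.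
have p24 : p2 + p4 = t1 + t3.
  rewrite /p2 /p4; apply: (mulIf pi1_neq0).
  by rewrite mulrDl !divfK // /pi1 /pi2; ring.
rewrite /u /v !eb2_uE !eb2_vE.
rewrite -!(scalemxAl, scalemxAr) !scalerA -!expRD (addrC p4) p24 (addrC t3).
congr (_ *: _).
by apply: mx2P; rewrite !(mulmx2E, mxE) /= /p1 /p2 /p3 /p4 /pi1 /pi2; field;
  rewrite -/pi1 -/pi2 pi1_neq0 pi2_neq0.
Qed.
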